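(* Let $L\colon\mathsf{A}\rightleftarrows\mathsf{X}\colon R$ be an adjunction between topoi, $L$ left adjoint to $R$, with $L$ preserving pullbacks. Then $({}_L\mathsf{Csp},\otimes,0_{\mathsf{A}})$ is a compact closed category, where $0_{\mathsf{A}}$ is the initial object of $\mathsf{A}$ and $\otimes\colon{}_L\mathsf{Csp}\times{}_L\mathsf{Csp}\to{}_L\mathsf{Csp}$ is given on objects by $a\otimes b=a+b$ and on arrows by $$(La\xrightarrow{f}x\xleftarrow{g}Lb)\otimes(La'\xrightarrow{f'}x'\xleftarrow{g'}Lb')=(L(a+a')\xrightarrow{f+f'}x+x'\xleftarrow{g+g'}L(b+b')).$$
   Context: ''Topos'' means elementary topos. A structured cospan is a cospan $La\to x\leftarrow Lb$ in $\mathsf{X}$ with $a,b\in\mathsf{A}$. ${}_L\mathsf{Csp}$ is the category whose objects are the objects of $\mathsf{A}$ and whose arrows $a\to b$ are structured cospans $La\to x\leftarrow Lb$ up to isomorphism, an isomorphism to $La\to x'\leftarrow Lb$ being an invertible arrow $x\to x'$ of $\mathsf{X}$ commuting with the legs. Composition is by pushout: $La\to x\leftarrow Lb$ followed by $Lb\to y\leftarrow Lc$ is $La\to x+_{Lb}y\leftarrow Lc$. In the formula for $\otimes$ the isomorphisms $L(a+a')\cong La+La'$ and $L(b+b')\cong Lb+Lb'$ are implicit. A symmetric monoidal category is compact closed if every object $\ell$ has a dual: an object $r$ with arrows $e\colon\ell\otimes r\to I$ and $c\colon I\to r\otimes\ell$ satisfying the triangle (snake) identities. *)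

(* Defs.v *)
From HB Require Import structures.
From mathcomp Require Import all_boot.
From mathcomp Require Import boolp.

Set Implicit Arguments.
Unset Strict Implicit.
Unset Printing Implicit Defensive.

Declare Scope cat_scope.
Delimit Scope cat_scope with cat.
Local Open Scope cat_scope.
Local Open Scope quotient_scope.

(* Composition is written in diagrammatic order: [f \; g] is f followed by g. *)
Record category := Category {
  obj :> Type;
  hom : obj -> obj -> Type;
  ident : forall a, hom a a;
  compose : forall a b c, hom a b -> hom b c -> hom a c;
  compose1c : forall a b (f : hom a b), compose (ident a) f = f;
  composec1 : forall a b (f : hom a b), compose f (ident b) = f;
  composeA : forall a b c d (f : hom a b) (g : hom b c) (h : hom c d),
    compose f (compose g h) = compose (compose f g) h
}.

Arguments hom {_} _ _.
Arguments ident {_} _.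
Arguments compose {_ _ _ _} _ _.

Notation "f \; g" := (compose f g) : cat_scope.

Definition is_iso (C : category) (a b : C) (f : hom a b) : Prop :=
  exists g : hom b a, f \; g = ident a /\ g \; f = ident b.

Record iso (C : category) (a b : C) := Iso {
  fwd : hom a b;
  bwd : hom b a;
  fwdK : fwd \; bwd = ident a;
  bwdK : bwd \; fwd = ident b
}.

Definition mono (C : category) (a b : C) (f : hom a b) : Prop :=
  forall (c : C) (g h : hom c a), g \; f = h \; f -> g = h.

Record functor (C D : category) := Functor {
  fobj :> C -> D;
  fmap : forall a b, hom a b -> hom (fobj a) (fobj b);
  fmap_id : forall a, fmap (ident a) = ident (fobj a);
  fmap_comp : forall a b c (f : hom a b) (g : hom b c),
    fmap (f \; g) = fmap f \; fmap g
}.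

Arguments fmap {_ _} _ {_ _} _.

Record adjunction (A X : category) (L : functor A X) (R : functor X A) :=
  Adjunction {
    adj_unit : forall a : A, hom a (R (L a));
    adj_counit : forall x : X, hom (L (R x)) x;
    adj_unit_natural : forall (a b : A) (f : hom a b),
      f \; adj_unit b = adj_unit a \; fmap R (fmap L f);
    adj_counit_natural : forall (x y : X) (f : hom x y),
      fmap L (fmap R f) \; adj_counit y = adj_counit x \; f;
    triangleL : forall a : A, fmap L (adj_unit a) \; adj_counit (L a) = ident (L a);
    triangleR : forall x : X, adj_unit (R x) \; fmap R (adj_counit x) = ident (R x)
  }.

Definition is_pullback (C : category) (a b c p : C) (f : hom a c) (g : hom b c)
    (p1 : hom p a) (p2 : hom p b) : Prop :=
  p1 \; f = p2 \; g /\
  forall (q : C) (q1 : hom q a) (q2 : hom q b), q1 \; f = q2 \; g ->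
    exists! u : hom q p, u \; p1 = q1 /\ u \; p2 = q2.

Definition is_pushout (C : category) (a b c p : C) (f : hom c a) (g : hom c b)
    (i1 : hom a p) (i2 : hom b p) : Prop :=
  f \; i1 = g \; i2 /\
  forall (q : C) (q1 : hom a q) (q2 : hom b q), f \; q1 = g \; q2 ->
    exists! u : hom p q, i1 \; u = q1 /\ i2 \; u = q2.

Definition preserves_pullbacks (C D : category) (F : functor C D) : Prop :=
  forall (a b c p : C) (f : hom a c) (g : hom b c) (p1 : hom p a) (p2 : hom p b),
    is_pullback f g p1 p2 ->
    is_pullback (fmap F f) (fmap F g) (fmap F p1) (fmap F p2).

Record finite_limits (C : category) := FiniteLimits {
  terminal : C;
  to_terminal : forall a, hom a terminal;
  to_terminal_unique : forall a (f : hom a terminal), f = to_terminal a;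
  product : C -> C -> C;
  pr1 : forall a b, hom (product a b) a;
  pr2 : forall a b, hom (product a b) b;
  pairing : forall a b c, hom c a -> hom c b -> hom c (product a b);
  pairing_pr1 : forall a b c (f : hom c a) (g : hom c b), pairing f g \; pr1 a b = f;
  pairing_pr2 : forall a b c (f : hom c a) (g : hom c b), pairing f g \; pr2 a b = g;
  pairing_unique : forall a b c (h : hom c (product a b)),
    h = pairing (h \; pr1 a b) (h \; pr2 a b);
  pullback : forall a b c, hom a c -> hom b c -> C;
  pb1 : forall a b c (f : hom a c) (g : hom b c), hom (pullback f g) a;
  pb2 : forall a b c (f : hom a c) (g : hom b c), hom (pullback f g) b;
  pullbackP : forall a b c (f : hom a c) (g : hom b c),
    is_pullback f g (pb1 f g) (pb2 f g)
}.

Record finite_colimits (C : category) := FiniteColimits {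
  initial : C;
  from_initial : forall a, hom initial a;
  from_initial_unique : forall a (f : hom initial a), f = from_initial a;
  coprod : C -> C -> C;
  inj1 : forall a b, hom a (coprod a b);
  inj2 : forall a b, hom b (coprod a b);
  copair : forall a b c, hom a c -> hom b c -> hom (coprod a b) c;
  inj1_copair : forall a b c (f : hom a c) (g : hom b c), inj1 a b \; copair f g = f;
  inj2_copair : forall a b c (f : hom a c) (g : hom b c), inj2 a b \; copair f g = g;
  copair_unique : forall a b c (h : hom (coprod a b) c),
    h = copair (inj1 a b \; h) (inj2 a b \; h);
  pushout : forall a b c, hom c a -> hom c b -> C;
  po1 : forall a b c (f : hom c a) (g : hom c b), hom a (pushout f g);
  po2 : forall a b c (f : hom c a) (g : hom c b), hom b (pushout f g);
  pushoutP : forall a b c (f : hom c a) (g : hom c b),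
    is_pushout f g (po1 f g) (po2 f g)
}.

Definition product_map (C : category) (lim : finite_limits C) (a a' b b' : C)
    (f : hom a b) (g : hom a' b') : hom (product lim a a') (product lim b b') :=
  pairing lim (pr1 lim a a' \; f) (pr2 lim a a' \; g).

Record exponentials (C : category) (lim : finite_limits C) := Exponentials {
  exponential : C -> C -> C;
  evaluation : forall a b, hom (product lim (exponential a b) a) b;
  exponentialP : forall (a b c : C) (f : hom (product lim c a) b),
    exists! g : hom c (exponential a b), product_map lim g (ident a) \; evaluation a b = f
}.

Record subobject_classifier (C : category) (lim : finite_limits C) :=
  SubobjectClassifier {
    omega : C;
    true_arrow : hom (terminal lim) omega;
    classifierP : forall (s a : C) (m : hom s a), mono m ->
      exists! chi : hom a omega,
        is_pullback chi true_arrow m (to_terminal lim s)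
  }.

(* Elementary topoi in the original sense of Lawvere and Tierney, with chosen
   structure: finite limits, finite colimits, exponentials and a subobject
   classifier. *)
Record topos := Topos {
  topos_cat :> category;
  topos_lim : finite_limits topos_cat;
  topos_colim : finite_colimits topos_cat;
  topos_exp : exponentials topos_lim;
  topos_omega : subobject_classifier topos_lim
}.

Notation "a + b" := (coprod (topos_colim _) a b) : cat_scope.
Notation "0_ A" := (initial (topos_colim A))
  (at level 1, A at level 1, format "0_ A") : cat_scope.

Definition coprod_map (C : topos) (a a' b b' : C) (f : hom a b) (g : hom a' b') :
    hom (a + a') (b + b') :=
  copair (topos_colim C) (f \; inj1 _ b b') (g \; inj2 _ b b').

(* The canonical isomorphism L(a + a') -> La + La'; that it is inverse to the
   comparison arrow is split_coprod_copair and copair_split_coprod. *)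
Definition split_coprod (A X : topos) (L : functor A X) (R : functor X A)
    (adj : adjunction L R) (a a' : A) : hom (L (a + a')) (L a + L a') :=
  fmap L (copair _ (adj_unit adj a \; fmap R (inj1 _ (L a) (L a')))
                   (adj_unit adj a' \; fmap R (inj2 _ (L a) (L a'))))
    \; adj_counit adj (L a + L a').

Lemma copair_ext (C : topos) (a b c : C) (f g : hom (a + b) c) :
  inj1 _ a b \; f = inj1 _ a b \; g -> inj2 _ a b \; f = inj2 _ a b \; g -> f = g.
Proof.
by move=> e1 e2; rewrite (copair_unique f) (copair_unique g) e1 e2.
Qed.

Lemma inj1_split_coprod (A X : topos) (L : functor A X) (R : functor X A)
    (adj : adjunction L R) (a a' : A) :
  fmap L (inj1 _ a a') \; split_coprod adj a a' = inj1 _ (L a) (L a').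
Proof.
rewrite /split_coprod composeA -fmap_comp inj1_copair fmap_comp -composeA.
by rewrite adj_counit_natural composeA triangleL compose1c.
Qed.

Lemma inj2_split_coprod (A X : topos) (L : functor A X) (R : functor X A)
    (adj : adjunction L R) (a a' : A) :
  fmap L (inj2 _ a a') \; split_coprod adj a a' = inj2 _ (L a) (L a').
Proof.
rewrite /split_coprod composeA -fmap_comp inj2_copair fmap_comp -composeA.
by rewrite adj_counit_natural composeA triangleL compose1c.
Qed.

Lemma left_adjoint_ext (A X : category) (L : functor A X) (R : functor X A)
    (adj : adjunction L R) (a : A) (x : X) (f g : hom (L a) x) :
  adj_unit adj a \; fmap R f = adj_unit adj a \; fmap R g -> f = g.
Proof.
have K (h : hom (L a) x) : fmap L (adj_unit adj a \; fmap R h) \; adj_counit adj x = h.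
  by rewrite fmap_comp -composeA adj_counit_natural composeA triangleL compose1c.
by move=> e; rewrite -(K f) -(K g) e.
Qed.

Lemma copair_split_coprod (A X : topos) (L : functor A X) (R : functor X A)
    (adj : adjunction L R) (a a' : A) :
  copair _ (fmap L (inj1 _ a a')) (fmap L (inj2 _ a a')) \; split_coprod adj a a'
  = ident (L a + L a').
Proof.
by apply: copair_ext; rewrite composeA ?inj1_copair ?inj2_copair composec1
  ?inj1_split_coprod ?inj2_split_coprod.
Qed.

Lemma split_coprod_copair (A X : topos) (L : functor A X) (R : functor X A)
    (adj : adjunction L R) (a a' : A) :
  split_coprod adj a a' \; copair _ (fmap L (inj1 _ a a')) (fmap L (inj2 _ a a'))
  = ident (L (a + a')).
Proof.
apply: (left_adjoint_ext (adj := adj)); apply: copair_ext;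
  rewrite !composeA adj_unit_natural -2!composeA -!fmap_comp;
  by rewrite composeA ?inj1_split_coprod ?inj2_split_coprod
    ?inj1_copair ?inj2_copair composec1.
Qed.

Record cospan (A X : category) (L : functor A X) (a b : A) := Cospan {
  apex : X;
  lleg : hom (L a) apex;
  rleg : hom (L b) apex
}.

(* Classical choice, required by {eq_quot _}. *)
HB.instance Definition _ (A X : category) (L : functor A X) (a b : A) :=
  gen_eqMixin (cospan L a b).
HB.instance Definition _ (A X : category) (L : functor A X) (a b : A) :=
  gen_choiceMixin (cospan L a b).

Section Cospans.
Variables (A X : category) (L : functor A X).

Definition cospan_iso (a b : A) (c d : cospan L a b) : Prop :=
  exists u : hom (apex c) (apex d),
    [/\ is_iso u, lleg c \; u = lleg d & rleg c \; u = rleg d].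

Definition cospan_isob (a b : A) : rel (cospan L a b) :=
  fun c d => `[< cospan_iso c d >].

Lemma cospan_isob_refl a b : reflexive (@cospan_isob a b).
Proof.
move=> c; apply/asboolP; exists (ident _); rewrite !composec1; split=> //.
by exists (ident _); rewrite compose1c.
Qed.

Lemma cospan_isob_sym a b : symmetric (@cospan_isob a b).
Proof.
have sym c d : @cospan_isob a b c d -> cospan_isob d c.
  move=> /asboolP [u [[v [uv vu]] e1 e2]]; apply/asboolP; exists v.
  split; first by exists u.
  - by rewrite -e1 -composeA uv composec1.
  - by rewrite -e2 -composeA uv composec1.
by move=> c d; apply/idP/idP; apply: sym.
Qed.

Lemma cospan_isob_trans a b : transitive (@cospan_isob a b).
Proof.
move=> d c e /asboolP [u [[u' [uu' u'u]] e1 e2]] /asboolP [v [[v' [vv' v'v]] e3 e4]].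
apply/asboolP; exists (u \; v); split; last 2 first.
- by rewrite composeA e1.
- by rewrite composeA e2.
exists (v' \; u'); split.
- by rewrite composeA -(composeA u) vv' composec1.
- by rewrite composeA -(composeA v') u'u composec1.
Qed.

Canonical cospan_equiv (a b : A) : equiv_rel (cospan L a b) :=
  EquivRel (@cospan_isob a b) (@cospan_isob_refl a b) (@cospan_isob_sym a b)
    (@cospan_isob_trans a b).

Definition cospan_hom (a b : A) : Type := {eq_quot (cospan_equiv a b)}.

Definition cospan_class (a b : A) (c : cospan L a b) : cospan_hom a b :=
  \pi_{eq_quot (cospan_equiv a b)} c.

Definition cospan_repr (a b : A) (f : cospan_hom a b) : cospan L a b :=
  repr (f : {eq_quot (cospan_equiv a b)}).

Lemma cospan_reprK a b (f : cospan_hom a b) : cospan_class (cospan_repr f) = f.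
Proof. exact: reprK. Qed.

Lemma cospan_classP a b (c d : cospan L a b) :
  cospan_class c = cospan_class d <-> cospan_iso c d.
Proof.
split; first by move/eqmodP => /= /asboolP.
by move=> e; apply/eqmodP/asboolP.
Qed.

Definition cospan_id (a : A) : cospan L a a := Cospan (ident (L a)) (ident (L a)).

End Cospans.

Arguments cospan_class {A X L a b} c.
Arguments cospan_repr {A X L a b} f.

Section StructuredCospans.
Variables (A : category) (X : topos) (L : functor A X).

Definition cospan_comp (a b c : A) (f : cospan L a b) (g : cospan L b c) :
    cospan L a c :=
  Cospan (lleg f \; po1 (topos_colim X) (rleg f) (lleg g))
         (rleg g \; po2 (topos_colim X) (rleg f) (lleg g)).

Lemma pushout_ext (C : category) (a b c p : C) (f : hom c a) (g : hom c b)
    (i1 : hom a p) (i2 : hom b p) (q : C) (u v : hom p q) :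
  is_pushout f g i1 i2 -> i1 \; u = i1 \; v -> i2 \; u = i2 \; v -> u = v.
Proof.
move=> [e H] e1 e2.
have [|w [_ wP]] := H q (i1 \; v) (i2 \; v); first by rewrite !composeA e.
by rewrite -(wP u (conj e1 e2)) -(wP v (conj erefl erefl)).
Qed.

Lemma cospan_comp_pushout (a b c : A) (f : cospan L a b) (g : cospan L b c)
    (p : X) (i1 : hom (apex f) p) (i2 : hom (apex g) p) :
  is_pushout (rleg f) (lleg g) i1 i2 ->
  cospan_iso (cospan_comp f g) (Cospan (lleg f \; i1) (rleg g \; i2)).
Proof.
move=> P; have Q := pushoutP (topos_colim X) (rleg f) (lleg g).
have [u [[u1 u2] _]] := Q.2 _ _ _ P.1.
have [v [[v1 v2] _]] := P.2 _ _ _ Q.1.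
exists u; split=> /=; last 2 first.
- by rewrite -composeA u1.
- by rewrite -composeA u2.
exists v; split.
- by apply: (pushout_ext Q); rewrite composeA ?u1 ?u2 composec1.
- by apply: (pushout_ext P); rewrite composeA ?v1 ?v2 composec1.
Qed.

Lemma cospan_comp_iso (a b c : A) (f f' : cospan L a b) (g g' : cospan L b c) :
  cospan_iso f f' -> cospan_iso g g' ->
  cospan_iso (cospan_comp f g) (cospan_comp f' g').
Proof.
case: f f' g g' => [x l r] [x' l' r'] [y m s] [y' m' s'] /=.
move=> [/= u [[u' [uu' u'u]] <- <-]] [/= v [[v' [vv' v'v]] <- <-]].
set F := Cospan l r; set G := Cospan m s.
have [e H] := pushoutP (topos_colim X) (r \; u) (m \; v).
move: e H; set i1 := po1 _ _ _; set i2 := po2 _ _ _ => e H.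
have P : is_pushout (rleg F) (lleg G) (u \; i1) (v \; i2).
  split=> [|q q1 q2 eq]; first by rewrite /= !composeA.
  have [|w [[w1 w2] wP]] := H q (u' \; q1) (v' \; q2).
    by rewrite -!composeA (composeA u) (composeA v) uu' vv' !compose1c.
  exists w; split; first by rewrite -!composeA w1 w2 !composeA uu' vv' !compose1c.
  move=> z [z1 z2]; apply: wP.
  by rewrite -z1 -z2 !composeA u'u v'v !compose1c.
have := cospan_comp_pushout P.
by rewrite /cospan_comp /= !composeA.
Qed.

(* Independence of the representatives is lcsp_compE. *)
Definition lcsp_comp (a b c : A) (f : cospan_hom L a b) (g : cospan_hom L b c) :
    cospan_hom L a c :=
  cospan_class (cospan_comp (cospan_repr f) (cospan_repr g)).

Lemma lcsp_compE (a b c : A) (f : cospan L a b) (g : cospan L b c) :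
  lcsp_comp (cospan_class f) (cospan_class g) = cospan_class (cospan_comp f g).
Proof.
by apply/cospan_classP/cospan_comp_iso; apply/cospan_classP; apply: cospan_reprK.
Qed.

Lemma lcsp_comp1c (a b : A) (f : cospan_hom L a b) :
  lcsp_comp (cospan_class (cospan_id L a)) f = f.
Proof.
rewrite -(cospan_reprK f) lcsp_compE; apply/cospan_classP.
case: (cospan_repr f) => x l r.
have P : is_pushout (rleg (cospan_id L a)) (lleg (Cospan l r)) l (ident x).
  split=> [|q q1 q2 /=]; first by rewrite compose1c composec1.
  rewrite compose1c => ->; exists q2; split; first by rewrite compose1c.
  by move=> u [_]; rewrite compose1c.
by have := cospan_comp_pushout P; rewrite /= compose1c composec1.
Qed.

Lemma lcsp_compc1 (a b : A) (f : cospan_hom L a b) :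
  lcsp_comp f (cospan_class (cospan_id L b)) = f.
Proof.
rewrite -(cospan_reprK f) lcsp_compE; apply/cospan_classP.
case: (cospan_repr f) => x l r.
have P : is_pushout (rleg (Cospan l r)) (lleg (cospan_id L b)) (ident x) r.
  split=> [|q q1 q2 /=]; first by rewrite compose1c composec1.
  rewrite compose1c => <-; exists q1; split; first by rewrite compose1c.
  by move=> u [+ _]; rewrite compose1c.
by have := cospan_comp_pushout P; rewrite /= compose1c composec1.
Qed.

Lemma lcsp_compA (a b c d : A) (f : cospan_hom L a b) (g : cospan_hom L b c)
    (h : cospan_hom L c d) :
  lcsp_comp f (lcsp_comp g h) = lcsp_comp (lcsp_comp f g) h.
Proof.
rewrite -(cospan_reprK f) -(cospan_reprK g) -(cospan_reprK h) !lcsp_compE.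
move: (cospan_repr f) (cospan_repr g) (cospan_repr h) => {}f {}g {}h.
set fg := cospan_comp f g; set gh := cospan_comp g h.
have [e1 H1] := pushoutP (topos_colim X) (rleg f) (lleg g).
have [e2 H2] := pushoutP (topos_colim X) (rleg g) (lleg h).
have P3 := pushoutP (topos_colim X) (rleg fg) (lleg h).
have [e3 H3] := P3.
have ext1 := pushout_ext (conj e1 H1); have ext3 := pushout_ext P3.
move: e1 H1 e2 H2 e3 H3 ext1 ext3 => /=.
set p1 := po1 _ (rleg f) _; set p2 := po2 _ (rleg f) _.
set q1 := po1 _ (rleg g) _; set q2 := po2 _ (rleg g) _.
set s1 := po1 _ (rleg g \; p2) _; set s2 := po2 _ (rleg g \; p2) _.
move=> e1 H1 e2 H2 e3 H3 ext1 ext3.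
have [|w [[w1 w2] _]] := H2 _ (p2 \; s1) s2; first by rewrite composeA.
have P : is_pushout (rleg f) (lleg gh) (p1 \; s1) w.
  split=> [|t t1 t2 et] /=.
    by rewrite -composeA w1 !composeA e1.
  rewrite /= -composeA in et.
  have [k [[k1 k2] _]] := H1 _ _ _ et.
  have [|z [[z1 z2] _]] := H3 _ k (q2 \; t2).
    by rewrite -composeA k2 !composeA e2.
  exists z; split.
    split; first by rewrite -composeA z1.
    apply: (pushout_ext (conj e2 H2)); rewrite composeA ?w1 ?w2 //.
    by rewrite -composeA z1.
  move=> y [y1 y2]; apply: ext3; last by rewrite z2 -y2 composeA w2.
  apply: ext1; rewrite z1 ?k1 ?k2 composeA //.
  by rewrite -y2 composeA w1.
apply/cospan_classP.
have := cospan_comp_pushout P.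
rewrite /fg /gh /cospan_comp /= -/p1 -/p2 -/q1 -/q2 -/s1 -/s2.
by rewrite -!(composeA (rleg h)) w2 -!(composeA (lleg f)).
Qed.

Definition LCsp : category :=
  @Category A (cospan_hom L) (fun a => cospan_class (cospan_id L a)) lcsp_comp
    lcsp_comp1c lcsp_compc1 lcsp_compA.

End StructuredCospans.

Arguments LCsp {A X} L.

Definition cospan_tensor (A X : topos) (L : functor A X) (R : functor X A)
    (adj : adjunction L R) (a b a' b' : A) (c : cospan L a b)
    (c' : cospan L a' b') : cospan L (a + a') (b + b') :=
  Cospan (split_coprod adj a a' \; coprod_map (lleg c) (lleg c'))
         (split_coprod adj b b' \; coprod_map (rleg c) (rleg c')).

(* Symmetric monoidal structures with prescribed action of the tensor product
   on objects and prescribed unit object. *)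
Record symmetric_monoidal (C : category) (ten : C -> C -> C) (one : C) :=
  SymmetricMonoidal {
    tensor : forall a b a' b' : C,
      hom a b -> hom a' b' -> hom (ten a a') (ten b b');
    tensor_id : forall a a' : C, tensor (ident a) (ident a') = ident (ten a a');
    tensor_comp : forall (a b c a' b' c' : C) (f : hom a b) (g : hom b c)
        (f' : hom a' b') (g' : hom b' c'),
      tensor (f \; g) (f' \; g') = tensor f f' \; tensor g g';
    assoc : forall a b c : C, iso (ten (ten a b) c) (ten a (ten b c));
    lunit : forall a : C, iso (ten one a) a;
    runit : forall a : C, iso (ten a one) a;
    braid : forall a b : C, iso (ten a b) (ten b a);
    assoc_natural : forall (a b c a' b' c' : C)
        (f : hom a a') (g : hom b b') (h : hom c c'),
      tensor (tensor f g) h \; fwd (assoc a' b' c')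
      = fwd (assoc a b c) \; tensor f (tensor g h);
    lunit_natural : forall (a b : C) (f : hom a b),
      tensor (ident one) f \; fwd (lunit b) = fwd (lunit a) \; f;
    runit_natural : forall (a b : C) (f : hom a b),
      tensor f (ident one) \; fwd (runit b) = fwd (runit a) \; f;
    braid_natural : forall (a b a' b' : C) (f : hom a b) (f' : hom a' b'),
      tensor f f' \; fwd (braid b b') = fwd (braid a a') \; tensor f' f;
    pentagon : forall a b c d : C,
      tensor (fwd (assoc a b c)) (ident d) \; fwd (assoc a (ten b c) d)
        \; tensor (ident a) (fwd (assoc b c d))
      = fwd (assoc (ten a b) c d) \; fwd (assoc a b (ten c d));
    triangle : forall a b : C,
      fwd (assoc a one b) \; tensor (ident a) (fwd (lunit b))
      = tensor (fwd (runit a)) (ident b);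
    hexagon : forall a b c : C,
      fwd (assoc a b c) \; fwd (braid a (ten b c)) \; fwd (assoc b c a)
      = tensor (fwd (braid a b)) (ident c) \; fwd (assoc b a c)
          \; tensor (ident b) (fwd (braid a c));
    braid_sym : forall a b : C,
      fwd (braid a b) \; fwd (braid b a) = ident (ten a b)
  }.

Definition is_dual (C : category) (ten : C -> C -> C) (one : C)
    (M : symmetric_monoidal ten one) (l r : C) : Prop :=
  exists (e : hom (ten l r) one) (c : hom one (ten r l)),
    bwd (runit M l) \; tensor M (ident l) c \; bwd (assoc M l r l)
      \; tensor M e (ident l) \; fwd (lunit M l) = ident l /\
    bwd (lunit M r) \; tensor M c (ident r) \; fwd (assoc M r l r)
      \; tensor M (ident r) e \; fwd (runit M r) = ident r.

Definition compact_closed (C : category) (ten : C -> C -> C) (one : C)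
    (M : symmetric_monoidal ten one) : Prop :=
  forall l : C, exists r : C, is_dual M l r.

(* Main.v *)
(* An arrow f : a -> b of A has a graph La -> Lb <- Lb, and f |-> graph f is
   functorial and compatible with the tensor products, so the coherence
   equations reduce to those of coproducts in A.  Naturality against an
   arbitrary cospan comes from an isomorphism of apexes in X, and functoriality
   of the tensor product from the fact that coproducts commute with pushouts.
   Every object is its own dual: unit and counit are the cospans
   L0 -> La <- L(a + a) and L(a + a) -> La <- L0 built from the codiagonal.
   Both snake identities come down to one pushout of a + a <- a + a + a -> a + a
   in A, which L preserves because it is a left adjoint. *)
From mathcomp Require Import ssreflect ssrfun ssrbool.
Require Import Defs.

Set Implicit Arguments.
Unset Strict Implicit.
Unset Printing Implicit Defensive.

Local Open Scope cat_scope.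

Local Notation in1 := (inj1 (topos_colim _)).
Local Notation in2 := (inj2 (topos_colim _)).
Local Notation cop := (copair (topos_colim _)).
Local Notation init := (from_initial (topos_colim _)).

(** * Coproducts in a topos and their coherence arrows *)

Section Coproducts.
Variable C : topos.

Lemma compose_assocr (D : category) (a b c d : D) (f : hom a b) (g : hom b c) (h : hom c d) :
  (f \; g) \; h = f \; (g \; h).
Proof. by rewrite composeA. Qed.

Lemma inj1_copairA (a b c d : C) (f : hom a c) (g : hom b c) (h : hom c d) :
  in1 a b \; (cop f g \; h) = f \; h.
Proof. by rewrite composeA inj1_copair. Qed.

Lemma inj2_copairA (a b c d : C) (f : hom a c) (g : hom b c) (h : hom c d) :
  in2 a b \; (cop f g \; h) = g \; h.
Proof. by rewrite composeA inj2_copair. Qed.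

(** Normal form for composites: everything is associated to the right, and the variants with a
    trailing factor let an injection cancel inside a longer composite. After [copair_ext] this
    settles the coherence equations summand by summand. *)
Definition coprodE := (compose_assocr, compose1c, composec1, @inj1_copair, @inj2_copair,
  inj1_copairA, inj2_copairA).

Lemma from_initial_ext (a : C) (f g : hom 0_C a) : f = g.
Proof. by rewrite (from_initial_unique f) (from_initial_unique g). Qed.

Definition codiag (a : C) : hom (a + a) a := cop (ident a) (ident a).

Definition coprod_assoc (a b c : C) : hom (a + b + c) (a + (b + c)) :=
  cop (cop (in1 _ _) (in1 b c \; in2 _ _))
    (in2 b c \; in2 _ _).

Definition coprod_assoc_inv (a b c : C) : hom (a + (b + c)) (a + b + c) :=
  cop (in1 a b \; in1 _ _)
    (cop (in2 a b \; in1 _ _) (in2 _ _)).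

Definition coprod_lunit (a : C) : hom (0_C + a) a :=
  cop (init a) (ident a).

Definition coprod_runit (a : C) : hom (a + 0_C) a :=
  cop (ident a) (init a).

Definition coprod_braid (a b : C) : hom (a + b) (b + a) :=
  cop (in2 b a) (in1 b a).

Lemma coprod_assocK (a b c : C) :
  coprod_assoc a b c \; coprod_assoc_inv a b c = ident _.
Proof. by do ![apply: copair_ext]; rewrite !coprodE. Qed.

Lemma coprod_assoc_invK (a b c : C) :
  coprod_assoc_inv a b c \; coprod_assoc a b c = ident _.
Proof. by do ![apply: copair_ext]; rewrite !coprodE. Qed.

Lemma coprod_lunitK (a : C) : coprod_lunit a \; in2 _ _ = ident _.
Proof.
by apply: copair_ext; rewrite !coprodE //; apply: from_initial_ext.
Qed.

Lemma inj2_lunit (a : C) : in2 _ _ \; coprod_lunit a = ident _.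
Proof. by rewrite !coprodE. Qed.

Lemma coprod_runitK (a : C) : coprod_runit a \; in1 _ _ = ident _.
Proof.
by apply: copair_ext; rewrite !coprodE //; apply: from_initial_ext.
Qed.

Lemma inj1_runit (a : C) : in1 _ _ \; coprod_runit a = ident _.
Proof. by rewrite !coprodE. Qed.

Lemma coprod_braidK (a b : C) : coprod_braid a b \; coprod_braid b a = ident _.
Proof. by apply: copair_ext; rewrite !coprodE. Qed.

Lemma coprod_map_id (a b : C) : coprod_map (ident a) (ident b) = ident (a + b).
Proof. by apply: copair_ext; rewrite !coprodE. Qed.

Lemma coprod_map_comp (a b c a' b' c' : C) (f : hom a b) (g : hom b c)
    (f' : hom a' b') (g' : hom b' c') :
  coprod_map (f \; g) (f' \; g') = coprod_map f f' \; coprod_map g g'.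
Proof. by apply: copair_ext; rewrite !coprodE. Qed.

Lemma coprod_map_iso (a b a' b' : C) (f : hom a b) (f' : hom a' b') :
  is_iso f -> is_iso f' -> is_iso (coprod_map f f').
Proof.
move=> [g [fg gf]] [g' [fg' gf']]; exists (coprod_map g g').
by rewrite -!coprod_map_comp fg fg' gf gf' !coprod_map_id.
Qed.

(** A cocone on the sum of two spans restricts along the injections to a cocone on each span; the
    two induced arrows are then copaired. *)
Lemma coprod_map_pushout (a b c p a' b' c' p' : C)
    (f : hom c a) (g : hom c b) (i : hom a p) (j : hom b p)
    (f' : hom c' a') (g' : hom c' b') (i' : hom a' p') (j' : hom b' p') :
  is_pushout f g i j -> is_pushout f' g' i' j' ->
  is_pushout (coprod_map f f') (coprod_map g g') (coprod_map i i') (coprod_map j j').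
Proof.
move=> P P'; split=> [|q q1 q2 e].
  by rewrite -!coprod_map_comp P.1 P'.1.
have [|u [[u1 u2] _]] := P.2 _ (in1 _ _ \; q1) (in1 _ _ \; q2).
  by move/(congr1 (compose (in1 _ _))): e; rewrite !coprodE.
have [|v [[v1 v2] _]] := P'.2 _ (in2 _ _ \; q1) (in2 _ _ \; q2).
  by move/(congr1 (compose (in2 _ _))): e; rewrite !coprodE.
exists (cop u v); split.
  by split; apply: copair_ext; rewrite !coprodE.
move=> w [w1 w2]; apply: copair_ext; rewrite !coprodE.
  by apply: (pushout_ext P); rewrite ?u1 ?u2 -?w1 -?w2 !coprodE.
by apply: (pushout_ext P'); rewrite ?v1 ?v2 -?w1 -?w2 !coprodE.
Qed.

(* Both legs identify all three summands of [a + a + a]; this is the pushout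
   behind the snake identities. *)
Lemma codiag_pushout (a : C) :
  is_pushout (coprod_assoc a a a \; coprod_map (ident a) (codiag a))
    (coprod_map (codiag a) (ident a)) (codiag a) (codiag a).
Proof.
split=> [|q q1 q2 e]; first by do ![apply: copair_ext]; rewrite !coprodE.
(* Restricted to the three summands, [e] forces all four components of [q1] and [q2] to coincide;
   their common value is the mediating arrow. *)
have := congr1 (compose (in1 _ _ \; in1 _ _)) e.
have := congr1 (compose (in2 _ _ \; in1 _ _)) e.
have := congr1 (compose (in2 _ _)) e.
rewrite !coprodE => e3 e2 e1; exists (in1 _ _ \; q1); split.
  split; apply: copair_ext; rewrite !coprodE //; first by rewrite e1 e2.
  by rewrite -e3 e2 e1.
by move=> u [<- _]; rewrite !coprodE.
Qed.

End Coproducts.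

(** * Pushout squares and isomorphisms *)

Lemma is_pushout_sym (C : category) (a b c p : C) (f : hom c a) (g : hom c b)
    (i1 : hom a p) (i2 : hom b p) :
  is_pushout f g i1 i2 -> is_pushout g f i2 i1.
Proof.
move=> [e H]; split=> // q q1 q2 eq.
have [u [[u1 u2] uP]] := H q q2 q1 (esym eq).
by exists u; split=> // v [v1 v2]; apply: uP.
Qed.

Lemma is_iso_id (C : category) (a : C) : is_iso (ident a).
Proof. by exists (ident a); rewrite compose1c. Qed.

Lemma fmap_iso (C D : category) (F : functor C D) (a b : C) (f : hom a b) :
  is_iso f -> is_iso (fmap F f).
Proof. by move=> [g [fg gf]]; exists (fmap F g); rewrite -!fmap_comp fg gf !fmap_id. Qed.

(** The mediating arrow can only be the inverse of [i] followed by [q1]. Composites with graphs are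
    computed from such squares. *)
Lemma iso_pushout (C : category) (a b c p : C) (f : hom c a) (g : hom c b)
    (i : hom a p) (j : hom b p) :
  is_iso g -> is_iso i -> f \; i = g \; j -> is_pushout f g i j.
Proof.
move=> [g' [gg' g'g]] [i' [ii' i'i]] e; split=> // q q1 q2 eq.
exists (i' \; q1); split; last by move=> u [<- _]; rewrite composeA i'i compose1c.
split; first by rewrite composeA ii' compose1c.
have -> : j = g' \; f \; i by rewrite e composeA g'g compose1c.
by rewrite !compose_assocr (composeA i) ii' compose1c eq composeA g'g compose1c.
Qed.

(** Meant for the comparison isomorphism that precedes both inner legs when two tensor products are
    composed. *)
Lemma pushout_precomp (C : category) (a b c d p : C) (f : hom c a) (g : hom c b)
    (i1 : hom a p) (i2 : hom b p) (s : hom d c) :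
  is_iso s -> is_pushout f g i1 i2 -> is_pushout (s \; f) (s \; g) i1 i2.
Proof.
move=> [t [_ ts]] [e H]; split=> [|q q1 q2]; first by rewrite !compose_assocr e.
move/(congr1 (compose t)); rewrite !composeA ts !compose1c.
exact: H.
Qed.

(** * Left adjoints preserve pushouts *)

Section LeftAdjoint.
Variables (A X : category) (L : functor A X) (R : functor X A).
Variable adj : adjunction L R.

Definition transpose (a : A) (x : X) (f : hom a (R x)) : hom (L a) x :=
  fmap L f \; adj_counit adj x.

Lemma transposeK (a : A) (x : X) (f : hom a (R x)) :
  adj_unit adj a \; fmap R (transpose f) = f.
Proof.
by rewrite fmap_comp composeA -adj_unit_natural compose_assocr triangleR composec1.
Qed.

(** A cocone with vertex [q] under the image square transposes to a cocone with vertex [R q] in [A];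
    its factorization is transposed back. *)
Lemma left_adjoint_pushout (a b c p : A) (f : hom c a) (g : hom c b)
    (i1 : hom a p) (i2 : hom b p) :
  is_pushout f g i1 i2 ->
  is_pushout (fmap L f) (fmap L g) (fmap L i1) (fmap L i2).
Proof.
move=> P; split=> [|q q1 q2 e]; first by rewrite -!fmap_comp P.1.
have [|u [[u1 u2] _]] := P.2 _ (adj_unit adj a \; fmap R q1) (adj_unit adj b \; fmap R q2).
  by rewrite !composeA !adj_unit_natural !compose_assocr -!fmap_comp e.
exists (transpose u); split.
  split; apply: (left_adjoint_ext (adj := adj));
    by rewrite fmap_comp composeA -adj_unit_natural compose_assocr transposeK ?u1 ?u2.
move=> v [v1 v2]; apply: (left_adjoint_ext (adj := adj)); rewrite transposeK.
apply: (pushout_ext P); rewrite ?u1 ?u2 composeA adj_unit_natural compose_assocr -fmap_comp;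
  by rewrite ?v1 ?v2.
Qed.

End LeftAdjoint.

(** * Coproducts under the left adjoint *)

Section Tensor.
Variables (A X : topos) (L : functor A X) (R : functor X A).
Variable adj : adjunction L R.

Local Notation split := (split_coprod adj).

Lemma left_adjoint_initial_ext (x : X) (f g : hom (L 0_A) x) : f = g.
Proof. by apply: (left_adjoint_ext (adj := adj)); apply: from_initial_ext. Qed.

(** By transposition the images of the injections stay jointly epic; this plays the role of
    [copair_ext] for legs of tensor products. *)
Lemma left_adjoint_coprod_ext (a b : A) (x : X) (f g : hom (L (a + b)) x) :
  fmap L (in1 a b) \; f = fmap L (in1 a b) \; g ->
  fmap L (in2 a b) \; f = fmap L (in2 a b) \; g -> f = g.
Proof.
move=> e1 e2; apply: (left_adjoint_ext (adj := adj)).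
by apply: copair_ext; rewrite !composeA !adj_unit_natural !compose_assocr -!fmap_comp ?e1 ?e2.
Qed.

Lemma inj1_splitA (a b : A) (x : X) (f : hom (L a + L b) x) :
  fmap L (in1 a b) \; (split a b \; f) = in1 _ _ \; f.
Proof. by rewrite composeA inj1_split_coprod. Qed.

Lemma inj2_splitA (a b : A) (x : X) (f : hom (L a + L b) x) :
  fmap L (in2 a b) \; (split a b \; f) = in2 _ _ \; f.
Proof. by rewrite composeA inj2_split_coprod. Qed.

Lemma fmap_inj1_copair (a b c : A) (f : hom a c) (g : hom b c) :
  fmap L (in1 a b) \; fmap L (cop f g) = fmap L f.
Proof. by rewrite -fmap_comp inj1_copair. Qed.

Lemma fmap_inj2_copair (a b c : A) (f : hom a c) (g : hom b c) :
  fmap L (in2 a b) \; fmap L (cop f g) = fmap L g.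
Proof. by rewrite -fmap_comp inj2_copair. Qed.

Lemma fmap_inj1_copairA (a b c : A) (x : X) (f : hom a c) (g : hom b c)
    (h : hom (L c) x) :
  fmap L (in1 a b) \; (fmap L (cop f g) \; h) = fmap L f \; h.
Proof. by rewrite composeA fmap_inj1_copair. Qed.

Lemma fmap_inj2_copairA (a b c : A) (x : X) (f : hom a c) (g : hom b c)
    (h : hom (L c) x) :
  fmap L (in2 a b) \; (fmap L (cop f g) \; h) = fmap L g \; h.
Proof. by rewrite composeA fmap_inj2_copair. Qed.

Definition splitE := (fmap_comp, fmap_id, inj1_split_coprod, inj2_split_coprod,
  inj1_splitA, inj2_splitA, fmap_inj1_copair, fmap_inj2_copair,
  fmap_inj1_copairA, fmap_inj2_copairA, coprodE).

Lemma split_iso (a b : A) : is_iso (split a b).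
Proof. by eexists; split; [exact: split_coprod_copair | exact: copair_split_coprod]. Qed.

Lemma split_natural (a b a' b' : A) (f : hom a b) (f' : hom a' b') :
  fmap L (coprod_map f f') \; split b b'
  = split a a' \; coprod_map (fmap L f) (fmap L f').
Proof. by apply: left_adjoint_coprod_ext; rewrite !splitE. Qed.

(** * The tensor product of structured cospans *)

Lemma cospan_tensor_iso (a b a' b' : A) (c d : cospan L a b) (c' d' : cospan L a' b') :
  cospan_iso c d -> cospan_iso c' d' ->
  cospan_iso (cospan_tensor adj c c') (cospan_tensor adj d d').
Proof.
move=> [u [Iu lu ru]] [u' [Iu' lu' ru']]; exists (coprod_map u u').
split; first exact: coprod_map_iso.
  by rewrite /= -lu -lu' coprod_map_comp composeA.
by rewrite /= -ru -ru' coprod_map_comp composeA.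
Qed.

(* Locked: otherwise rewriting with [lcsp_compE] or [lcsp_tensorE] unfolds it to
   match [cospan_class]. *)
Fact lcsp_tensor_key : unit. Proof. exact: tt. Qed.
Definition lcsp_tensor (a b a' b' : A) (f : cospan_hom L a b) (g : cospan_hom L a' b') :
    cospan_hom L (a + a') (b + b') :=
  locked_with lcsp_tensor_key
    (cospan_class (cospan_tensor adj (cospan_repr f) (cospan_repr g))).

Lemma lcsp_tensorE (a b a' b' : A) (c : cospan L a b) (c' : cospan L a' b') :
  lcsp_tensor (cospan_class c) (cospan_class c') = cospan_class (cospan_tensor adj c c').
Proof.
rewrite /lcsp_tensor unlock.
by apply/cospan_classP/cospan_tensor_iso; apply/cospan_classP; apply: cospan_reprK.
Qed.

Lemma lcsp_comp_pushout (a b c : A) (f : cospan L a b) (g : cospan L b c)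
    (p : X) (i1 : hom (apex f) p) (i2 : hom (apex g) p) :
  is_pushout (rleg f) (lleg g) i1 i2 ->
  lcsp_comp (cospan_class f) (cospan_class g)
  = cospan_class (Cospan (lleg f \; i1) (rleg g \; i2)).
Proof. by move=> P; rewrite lcsp_compE; apply/cospan_classP/cospan_comp_pushout. Qed.

Lemma lcsp_tensor_comp (a b c a' b' c' : A) (f : cospan_hom L a b)
    (g : cospan_hom L b c) (f' : cospan_hom L a' b') (g' : cospan_hom L b' c') :
  lcsp_tensor (lcsp_comp f g) (lcsp_comp f' g')
  = lcsp_comp (lcsp_tensor f f') (lcsp_tensor g g').
Proof.
rewrite -(cospan_reprK f) -(cospan_reprK g) -(cospan_reprK f') -(cospan_reprK g').
move: (cospan_repr f) (cospan_repr g) (cospan_repr f') (cospan_repr g').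
move=> {}f {}g {}f' {}g'; rewrite !lcsp_compE !lcsp_tensorE.
have P := pushoutP (topos_colim X) (rleg f) (lleg g).
have P' := pushoutP (topos_colim X) (rleg f') (lleg g').
(* The sum of the two chosen pushouts is a pushout for the composite of the tensor products;
   computed with it, both sides have the same apex and legs. *)
have Q := pushout_precomp (split_iso b b') (coprod_map_pushout P P').
rewrite (lcsp_comp_pushout (f := cospan_tensor adj f f')
  (g := cospan_tensor adj g g') Q).
by rewrite /cospan_tensor /= !coprod_map_comp !composeA.
Qed.

(** * Cospans and graphs that come from [A] *)

Definition base_cospan (a b x : A) (f : hom a x) (g : hom b x) : cospan_hom L a b :=
  cospan_class (@Cospan A X L a b (L x) (fmap L f) (fmap L g)).

Definition graph (a b : A) (f : hom a b) : cospan_hom L a b := base_cospan f (ident b).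

Lemma graph_id (a : A) : graph (ident a) = cospan_class (cospan_id L a).
Proof. by rewrite /graph /base_cospan fmap_id. Qed.

(** Any pushout in [A] may be used, since [L] preserves it and the class does not depend on the
    choice of pushout in [X]. *)
Lemma base_cospan_comp (a b c x y z : A) (f : hom a x) (g : hom b x) (h : hom b y)
    (k : hom c y) (i : hom x z) (j : hom y z) :
  is_pushout g h i j ->
  lcsp_comp (base_cospan f g) (base_cospan h k) = base_cospan (f \; i) (k \; j).
Proof.
move=> /(left_adjoint_pushout adj) P; rewrite /base_cospan !fmap_comp.
exact: (lcsp_comp_pushout (f := Cospan _ _) (g := Cospan _ _) P).
Qed.

(** The comparison arrow [split x x'] is an isomorphism of apexes, and its naturality matches the
    legs. *)
Lemma base_cospan_tensor (a b x a' b' x' : A) (f : hom a x) (g : hom b x)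
    (f' : hom a' x') (g' : hom b' x') :
  lcsp_tensor (base_cospan f g) (base_cospan f' g')
  = base_cospan (coprod_map f f') (coprod_map g g').
Proof.
rewrite lcsp_tensorE; apply/esym/cospan_classP; exists (split x x').
by split; [exact: split_iso | exact: split_natural | exact: split_natural].
Qed.

Lemma graph_base_cospan (a b c x : A) (f : hom a b) (h : hom b x) (k : hom c x) :
  lcsp_comp (graph f) (base_cospan h k) = base_cospan (f \; h) k.
Proof.
rewrite (@base_cospan_comp _ _ _ _ _ _ _ _ _ _ h (ident x)) ?composec1 //.
by apply/is_pushout_sym/iso_pushout; rewrite ?composec1 ?compose1c //; apply: is_iso_id.
Qed.

(** Invertibility of [h] lets the composite keep the apex [x]: the graph is absorbed into the right
    leg through the inverse [k]. *)
Lemma base_cospan_graph (a b c x : A) (f : hom a x) (g : hom b x) (h : hom b c)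
    (k : hom c b) :
  h \; k = ident b -> k \; h = ident c ->
  lcsp_comp (base_cospan f g) (graph h) = base_cospan f (k \; g).
Proof.
move=> hk kh; rewrite (@base_cospan_comp _ _ _ _ _ _ _ _ _ _ (ident x) (k \; g)).
  by rewrite composec1 compose1c.
apply: iso_pushout; [by exists k | exact: is_iso_id |].
by rewrite composec1 composeA hk compose1c.
Qed.

Lemma graph_comp (a b c : A) (f : hom a b) (g : hom b c) :
  lcsp_comp (graph f) (graph g) = graph (f \; g).
Proof. by rewrite graph_base_cospan. Qed.

Lemma graph_tensor (a b a' b' : A) (f : hom a b) (f' : hom a' b') :
  lcsp_tensor (graph f) (graph f') = graph (coprod_map f f').
Proof. by rewrite base_cospan_tensor coprod_map_id. Qed.

(** Transparent, so that [fwd] and [bwd] of the structure isomorphisms compute to graphs. *)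
Definition graph_iso (a b : A) (f : hom a b) (g : hom b a)
    (fg : f \; g = ident a) (gf : g \; f = ident b) : @iso (LCsp L) a b.
Proof.
exists (graph f) (graph g); first by rewrite /= graph_comp fg graph_id.
by rewrite /= graph_comp gf graph_id.
Defined.

(** * Naturality of the structure isomorphisms *)

Lemma graph_natural (a b a' b' : A) (c : cospan L a b) (c' : cospan L a' b')
    (f : hom a a') (g : hom b b') :
  is_iso g ->
  (exists w : hom (apex c) (apex c'),
    [/\ is_iso w, lleg c \; w = fmap L f \; lleg c' & rleg c \; w = fmap L g \; rleg c']) ->
  lcsp_comp (cospan_class c) (graph g) = lcsp_comp (graph f) (cospan_class c').
Proof.
move=> Ig [w [Iw el er]].
(* Since [w] and [fmap L g] are invertible, the square of right legs is a pushout, so both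
   composites can be computed with the apex of [c']. *)
have P : is_pushout (rleg c) (lleg (Cospan (fmap L g) (fmap L (ident b')))) w (rleg c').
  by apply: iso_pushout => //; apply: fmap_iso.
have Q : is_pushout (rleg (Cospan (fmap L f) (fmap L (ident a')))) (lleg c')
    (lleg c') (ident _).
  rewrite /= fmap_id; apply/is_pushout_sym/iso_pushout; try exact: is_iso_id.
  by rewrite compose1c composec1.
rewrite (lcsp_comp_pushout P) (lcsp_comp_pushout Q) /=.
by rewrite el fmap_id compose1c composec1.
Qed.

Lemma lcsp_assoc_natural (a b c a' b' c' : A) (f : cospan_hom L a a')
    (g : cospan_hom L b b') (h : cospan_hom L c c') :
  lcsp_comp (lcsp_tensor (lcsp_tensor f g) h) (graph (coprod_assoc a' b' c'))
  = lcsp_comp (graph (coprod_assoc a b c)) (lcsp_tensor f (lcsp_tensor g h)).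
Proof.
rewrite -(cospan_reprK f) -(cospan_reprK g) -(cospan_reprK h) !lcsp_tensorE.
(* The isomorphism of apexes is the associator of coproducts in [X]. *)
apply: graph_natural; [|exists (coprod_assoc _ _ _); split] => /=.
- exists (coprod_assoc_inv _ _ _).
  by rewrite coprod_assocK coprod_assoc_invK.
- exists (coprod_assoc_inv _ _ _).
  by rewrite coprod_assocK coprod_assoc_invK.
- by do ![apply: left_adjoint_coprod_ext]; rewrite !splitE.
- by do ![apply: left_adjoint_coprod_ext]; rewrite !splitE.
Qed.

Lemma lcsp_lunit_natural (a b : A) (f : cospan_hom L a b) :
  lcsp_comp (lcsp_tensor (cospan_class (cospan_id L 0_A)) f) (graph (coprod_lunit b))
  = lcsp_comp (graph (coprod_lunit a)) f.
Proof.
rewrite -(cospan_reprK f) lcsp_tensorE.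
(* The unit contributes [L 0_A] to the apex. It is initial in [X], its arrows being transposes of
   arrows out of [0_A], so this copairing is invertible. *)
apply: graph_natural; [|exists (cop (transpose adj (init _)) (ident _)); split] => /=.
- by exists (in2 _ _); rewrite coprod_lunitK inj2_lunit.
- exists (in2 _ _); split; last by rewrite !coprodE.
  by apply: copair_ext; rewrite !coprodE //; apply: left_adjoint_initial_ext.
- by apply: left_adjoint_coprod_ext; rewrite ?splitE //; apply: left_adjoint_initial_ext.
- by apply: left_adjoint_coprod_ext; rewrite ?splitE //; apply: left_adjoint_initial_ext.
Qed.

Lemma lcsp_runit_natural (a b : A) (f : cospan_hom L a b) :
  lcsp_comp (lcsp_tensor f (cospan_class (cospan_id L 0_A))) (graph (coprod_runit b))
  = lcsp_comp (graph (coprod_runit a)) f.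
Proof.
rewrite -(cospan_reprK f) lcsp_tensorE.
apply: graph_natural; [|exists (cop (ident _) (transpose adj (init _))); split] => /=.
- by exists (in1 _ _); rewrite coprod_runitK inj1_runit.
- exists (in1 _ _); split; last by rewrite !coprodE.
  by apply: copair_ext; rewrite !coprodE //; apply: left_adjoint_initial_ext.
- by apply: left_adjoint_coprod_ext; rewrite ?splitE //; apply: left_adjoint_initial_ext.
- by apply: left_adjoint_coprod_ext; rewrite ?splitE //; apply: left_adjoint_initial_ext.
Qed.

Lemma lcsp_braid_natural (a b a' b' : A) (f : cospan_hom L a b) (f' : cospan_hom L a' b') :
  lcsp_comp (lcsp_tensor f f') (graph (coprod_braid b b'))
  = lcsp_comp (graph (coprod_braid a a')) (lcsp_tensor f' f).
Proof.
rewrite -(cospan_reprK f) -(cospan_reprK f') !lcsp_tensorE.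
apply: graph_natural; [|exists (coprod_braid _ _); split] => /=.
- by exists (coprod_braid _ _); rewrite !coprod_braidK.
- by exists (coprod_braid _ _); rewrite !coprod_braidK.
- by apply: left_adjoint_coprod_ext; rewrite !splitE.
- by apply: left_adjoint_coprod_ext; rewrite !splitE.
Qed.

(** * The symmetric monoidal structure and its duals *)

Definition lcsp_monoidal :
  @symmetric_monoidal (LCsp L) (fun a b : A => a + b) 0_A.
Proof.
unshelve refine (@SymmetricMonoidal (LCsp L) (fun a b : A => a + b) 0_A
  lcsp_tensor _ lcsp_tensor_comp
  (fun a b c => graph_iso (coprod_assocK a b c) (coprod_assoc_invK a b c))
  (fun a => graph_iso (coprod_lunitK a) (inj2_lunit a))
  (fun a => graph_iso (coprod_runitK a) (inj1_runit a))
  (fun a b => graph_iso (coprod_braidK a b) (coprod_braidK b a))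
  lcsp_assoc_natural lcsp_lunit_natural lcsp_runit_natural lcsp_braid_natural
  _ _ _ _) => /=.
- by move=> a a'; rewrite -!graph_id graph_tensor coprod_map_id.
(* With identities written as graphs, each side collapses to a single graph, leaving the coherence
   equation in [A]. *)
- move=> a b c d; rewrite -!graph_id !graph_tensor !graph_comp; congr graph.
  by do ![apply: copair_ext]; rewrite !coprodE.
- move=> a b; rewrite -!graph_id !graph_tensor !graph_comp; congr graph.
  do ![apply: copair_ext]; rewrite !coprodE //; apply: from_initial_ext.
- move=> a b c; rewrite -!graph_id !graph_tensor !graph_comp; congr graph.
  by do ![apply: copair_ext]; rewrite !coprodE.
- by move=> a b; rewrite graph_comp coprod_braidK graph_id.
Defined.

Lemma lcsp_self_dual (a : A) : is_dual lcsp_monoidal a a.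
Proof.
exists (base_cospan (codiag a) (init a)), (base_cospan (init a) (codiag a)).
(* Unfolding [graph] exposes the identities as base cospans, so their tensor products with the unit
   and counit become base cospans too. *)
rewrite /= -!graph_id /graph !base_cospan_tensor -!/(graph _).
split.
- rewrite (base_cospan_graph _ _ (coprod_lunitK a) (inj2_lunit a)).
  rewrite lcsp_compA graph_base_cospan lcsp_compA.
  (* The inverse associator moves into the right leg of the first cospan as [coprod_assoc], which
     gives the span of [codiag_pushout]. *)
  rewrite (base_cospan_graph _ _ (coprod_assoc_invK _ _ _) (coprod_assocK _ _ _)).
  rewrite (base_cospan_comp _ _ (codiag_pushout a)).
  by congr base_cospan; rewrite !coprodE.
- rewrite (base_cospan_graph _ _ (coprod_runitK a) (inj1_runit a)).
  (* Here the associator goes into the left leg of the second cospan, so the same pushout occurs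
     with its two sides exchanged. *)
  rewrite graph_base_cospan lcsp_compA graph_base_cospan.
  rewrite (base_cospan_comp _ _ (is_pushout_sym (codiag_pushout a))).
  by congr base_cospan; rewrite !coprodE.
Qed.

End Tensor.

Theorem proposition6 (A X : topos) (L : functor A X) (R : functor X A)
    (adj : adjunction L R) (Lpb : preserves_pullbacks L) :
  exists M : @symmetric_monoidal (LCsp L) (fun a b : A => a + b) 0_A,
    (forall (a b a' b' : A) (c : cospan L a b) (c' : cospan L a' b'),
       tensor M (cospan_class c : @hom (LCsp L) a b)
                (cospan_class c' : @hom (LCsp L) a' b')
       = cospan_class (cospan_tensor adj c c')) /\
    compact_closed M.
Proof.
exists (lcsp_monoidal adj); split=> [a b a' b' c c'|a]; first exact: lcsp_tensorE.
by exists a; apply: lcsp_self_dual.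
Qed.
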